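(* Let $\vec{\mathcal T}$ be the family of finite oriented graphs that contain no $\vec T_3$. Then $$I(\vec P_4,\vec{\mathcal T})=\frac{24}{125}.$$ Moreover, there exists $n_1$ such that for every positive integer $n$ with $n\ge n_1$ or $5\mid n$, the following holds: an $n$-vertex oriented graph $G\in\vec{\mathcal T}$ maximizes the number of induced copies of $\vec P_4$ among all $n$-vertex oriented graphs in $\vec{\mathcal T}$ if and only if $G$ is isomorphic to a balanced blow-up of $\vec C_5$ on $n$ vertices.
   Context: An oriented graph is a (finite, loopless) directed graph without 2-cycles, i.e. between any two distinct vertices there is at most one directed edge. $\vec T_3$ is the transitive tournament on three vertices; an oriented graph is $\vec T_3$-free if it does not contain $\vec T_3$ as a subgraph. $\vec P_k$ is the directed path on $k$ vertices $v_1\to v_2\to\cdots\to v_k$, and $\vec C_5$ is the directed cycle on 5 vertices. For oriented graphs $G,H$, the number of induced copies of $H$ in $G$ is the number of $|V(H)|$-element subsets of $V(G)$ that induce an oriented graph isomorphic to $H$, and $$d_H(G)=\frac{\#\text{ of induced copies of }H\text{ in }G}{\binom{|V(G)|}{|V(H)|}}.$$ For a family $\mathcal G$ of oriented graphs, the inducibility of $H$ in $\mathcal G$ is $$I(H,\mathcal G)=\lim_{n\to\infty}\ \max_{|V(G)|=n,\ G\in\mathcal G} d_H(G),$$ if the limit exists. A balanced blow-up of $\vec C_5$ on $n$ vertices is an oriented graph whose vertex set is partitioned into five classes $X_1,\dots,X_5$, each of size $\lfloor n/5\rfloor$ or $\lceil n/5\rceil$, whose edges are exactly all pairs directed from $X_i$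 to $X_{i+1}$ for $i=1,\dots,5$ (indices modulo 5); in particular there are no edges inside the classes. *)

(* Defs.v *)
From HB Require Import structures.
From mathcomp Require Import all_boot all_order all_algebra.
From mathcomp Require Import all_classical all_reals all_analysis.

Set Implicit Arguments.
Unset Strict Implicit.
Unset Printing Implicit Defensive.

Import Order.TTheory GRing.Theory Num.Theory.
Import numFieldNormedType.Exports.

Local Open Scope classical_set_scope.
Local Open Scope ring_scope.

Record ograph := OGraph {
  vertex :> finType;
  arc : rel vertex;
  arc_irr : irreflexive arc;
  arc_asym : forall x y, arc x y -> ~~ arc y x
}.
Arguments arc {o}.

Definition isomorphic (G H : ograph) : Prop :=
  exists2 f : G -> H, bijective f & forall x y, arc (f x) (f y) = arc x y.

(* [H] is a subgraph of [G], not necessarily induced. *)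
Definition contains (G H : ograph) : Prop :=
  exists2 f : H -> G, injective f & forall x y, arc x y -> arc (f x) (f y).

Section Induced.
Variables (G : ograph) (S : {set G}).

Definition induced_arc : rel {x : G | x \in S} :=
  fun x y => arc (val x) (val y).

Lemma induced_irr : irreflexive induced_arc.
Proof. by move=> x; exact: arc_irr. Qed.

Lemma induced_asym x y : induced_arc x y -> ~~ induced_arc y x.
Proof. exact: arc_asym. Qed.

Definition induced : ograph := OGraph induced_irr induced_asym.

End Induced.

Definition induced_copies (H G : ograph) : nat :=
  #|[set S : {set G} | (#|S| == #|H|) && `[< isomorphic (induced S) H >]]%SET|.

Definition density (R : realType) (H G : ograph) : R :=
  (induced_copies H G)%:R / 'C(#|G|, #|H|)%:R.

Definition is_max_density (R : realType) (H : ograph) (F : ograph -> Prop)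
    (n : nat) (d : R) : Prop :=
  (exists G : ograph, [/\ F G, #|G| = n & density R H G = d]) /\
  (forall G : ograph, F G -> #|G| = n -> density R H G <= d).

(* The limit defining the inducibility of [H] in [F] exists and equals [l];
   the maximum only has to exist for large [n]. *)
Definition is_inducibility (R : realType) (H : ograph) (F : ograph -> Prop)
    (l : R) : Prop :=
  exists2 u : nat -> R,
    (\forall n \near \oo, is_max_density H F n (u n)) & u @ \oo --> l.

Section TransitiveTournament.
Variable k : nat.

Definition tt_arc : rel 'I_k := fun i j => (i < j)%N.

Lemma tt_irr : irreflexive tt_arc.
Proof. by move=> i; exact: ltnn. Qed.

Lemma tt_asym i j : tt_arc i j -> ~~ tt_arc j i.
Proof. by rewrite /tt_arc -leqNgt => /ltnW. Qed.

Definition transitive_tournament : ograph := OGraph tt_irr tt_asym.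

End TransitiveTournament.

Section DirectedPath.
Variable k : nat.

Definition dpath_arc : rel 'I_k := fun i j => (j == i.+1 :> nat).

Lemma dpath_irr : irreflexive dpath_arc.
Proof. by move=> i; rewrite /dpath_arc ltn_eqF. Qed.

Lemma dpath_asym i j : dpath_arc i j -> ~~ dpath_arc j i.
Proof.
rewrite /dpath_arc => /eqP ->.
by rewrite ltn_eqF // ltnS leqW.
Qed.

(* [k] is the number of vertices. *)
Definition dpath : ograph := OGraph dpath_irr dpath_asym.

End DirectedPath.

Definition C5_arc : rel 'I_5 := fun i j => (j == i.+1 %% 5 :> nat)%N.

Lemma C5_irr : irreflexive C5_arc.
Proof. by case=> [[|[|[|[|[|]]]]]]. Qed.

Lemma C5_asym i j : C5_arc i j -> ~~ C5_arc j i.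
Proof. by case: i j => [[|[|[|[|[|]]]]] ?] // [[|[|[|[|[|]]]]] ?]. Qed.

Definition C5 : ograph := OGraph C5_irr C5_asym.

Definition T3free (G : ograph) : Prop :=
  ~ contains G (transitive_tournament 3).

(* [c] sends a vertex to the index of its class; the two allowed class sizes
   are the floor and the ceiling of #|B| / 5. *)
Definition balanced_C5_blowup (B : ograph) : Prop :=
  exists c : B -> C5,
    (forall i : C5, let m := #|[set x : B | c x == i]%SET| in
       m = (#|B| %/ 5)%N \/ m = ((#|B| + 4) %/ 5)%N) /\
    (forall x y : B, arc x y = arc (c x) (c y)).

Definition maximizes_copies (H : ograph) (F : ograph -> Prop) (G : ograph) :
    Prop :=
  F G /\ forall G' : ograph, F G' -> #|G'| = #|G| ->
    (induced_copies H G' <= induced_copies H G)%N.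

(* Main.v *)
Require Import Defs.
From HB Require Import structures.
From mathcomp Require Import all_boot all_order all_algebra.
From mathcomp Require Import all_classical all_reals all_analysis.
From mathcomp Require Import zify ring lra.
From mathcomp.zify Require Import ssrZ.
From Corelib Require BinNums.

Set Implicit Arguments.
Unset Strict Implicit.
Unset Printing Implicit Defensive.

Import Order.TTheory GRing.Theory Num.Theory.
Import numFieldNormedType.Exports.
(* [arc] also names the arcs of a cyclic sequence; the graphs take precedence. *)
Import Defs.

Local Open Scope ring_scope.

Local Notation Z := BinNums.Z.

(** Let [P] be the number of induced copies of the path [v1 -> v2 -> v3 -> v4]
    in a [T3]-free graph [G] on [n] vertices; it is also the number of ordered
    quadruples that span such a path in this order.

    The upper bound [125 P <= n ^ 4] comes from a sum of squares over pairs of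
    vertices. To every ordered pair [(a, b)] one attaches a nonnegative
    quadratic form in the numbers of vertices that see [a] and [b] in a given
    way, a form which vanishes on the balanced blow-up of [C5]. Summed over all
    pairs, such forms become sums over all quadruples, hence, after
    symmetrization, sums over the isomorphism types of graphs on four vertices
    (a quadruple with repetitions stands for a graph with nonadjacent twins).
    The forms of [squares] are such that
      [72 n ^ 4 - 9000 P - sum of the squares]
    is a sum of contributions of quadruples which are all nonnegative, and which
    vanish only on the quadruples that span a subgraph of a blow-up of [C5]
    ([sym_local_slack]). There are finitely many types to check.

    The positive contributions measure how far [G] is from a blow-up. An arc
    [a -> b] sorts the vertices of a blow-up of [C5] into the five classes, since
    every class sees [a] and [b] in its own way; apply this rule to [G] and call
    a pair of vertices misplaced when it does not have the adjacency that its
    labels predict. A misplaced pair makes a positive contribution together with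
    [a] and [b], so [path4_misfit_bound] bounds the sum over all arcs of the
    numbers of misplaced pairs by [4 / 5 (n ^ 4 - 125 P)]. If [G] has at least as
    many paths as the balanced blow-up, this is [O(n ^ 2)] while there are at
    least [n ^ 2 / 12] arcs: some arc has a bounded number of misplaced pairs.

    A bounded number of misplaced pairs cannot pay off: a path through only one
    misplaced pair never exists in [G], a misplaced pair destroys a quadratic
    number of paths of the blow-up ([misplaced_loss]), and only linearly many
    quadruples contain three vertices or more that lie in misplaced pairs. Thus for large
    [n] there are none and [G] is a blow-up; when [5] divides [n] the bound is
    attained and the same follows at once. Among blow-ups, moving a vertex from a
    large class to a small one increases the number of paths unless the sizes
    differ by at most one ([e4_le_max], [e4_eq_max]). *)

(** * Adjacency codes *)

(** A type with three decidable values, so that statements on graphs with four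
    vertices can be checked by evaluation. A vertex is [Apart] from itself: a
    repeated vertex behaves like a pair of nonadjacent twins. *)
Definition dir := option bool.

Notation To := (Some true).
Notation From := (Some false).
Notation Apart := None.

Definition flip (r : dir) : dir := omap negb r.

Definition dir_of (G : ograph) (x y : G) : dir :=
  if arc x y then To else if arc y x then From else Apart.

Lemma dir_ofC (G : ograph) (x y : G) : dir_of y x = flip (dir_of x y).
Proof.
rewrite /dir_of; case: (boolP (arc x y)) => [/arc_asym/negbTE -> //|_].
by case: (arc y x).
Qed.

Lemma dir_ofxx (G : ograph) (x : G) : dir_of x x = Apart.
Proof. by rewrite /dir_of arc_irr. Qed.

Lemma dir_of_To (G : ograph) (x y : G) : (dir_of x y == To) = arc x y.
Proof. by rewrite /dir_of; case: ifP => // _; case: ifP. Qed.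

Definition all_dir (P : dir -> bool) := [&& P To, P From & P Apart].

Lemma all_dirP (P : dir -> bool) : all_dir P -> forall r, P r.
Proof. by move=> /and3P[? ? ?] [[]|]. Qed.

Definition all_C5 (P : C5 -> bool) :=
  [&& P (@Ordinal 5 0 isT), P (@Ordinal 5 1 isT), P (@Ordinal 5 2 isT),
      P (@Ordinal 5 3 isT) & P (@Ordinal 5 4 isT)].

Lemma all_C5P (P : C5 -> bool) : all_C5 P -> forall i, P i.
Proof.
move=> /and5P[P0 P1 P2 P3 P4].
by move=> [[|[|[|[|[|//]]]]] lti]; rewrite (bool_irrelevance lti isT).
Qed.

(** Here [r], [s] and [t] are the codes of pairs [(x, y)], [(y, z)], [(x, z)];
    the only tournaments that remain are the two cyclic ones. *)
Definition tri_ok (r s t : dir) : bool :=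
  [|| r == Apart, s == Apart, t == Apart,
      [&& r == To, s == To & t == From] | [&& r == From, s == From & t == To]].

Lemma T3free_arc (G : ograph) : T3free G ->
  forall x y z : G, arc x y -> arc y z -> ~~ arc x z.
Proof.
move=> T3G x y z xy yz; apply/negP => xz; apply: T3G.
have xNy : x != y by apply: contraTneq xy => ->; rewrite arc_irr.
have yNz : y != z by apply: contraTneq yz => ->; rewrite arc_irr.
have xNz : x != z by apply: contraTneq xz => ->; rewrite arc_irr.
pose f (i : 'I_3) := nth x [:: x; y; z] i.
exists (f : transitive_tournament 3 -> G).
- move=> i j /eqP; rewrite /f nth_uniq //= ?inE ?(negbTE xNy) ?xNz ?yNz //.
  by move/eqP/val_inj.
- by move=> [[|[|[|]]] //= ?] [[|[|[|]]] //= ?].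
Qed.

Lemma T3free_tri_ok (G : ograph) : T3free G ->
  forall x y z : G, tri_ok (dir_of x y) (dir_of y z) (dir_of x z).
Proof.
move=> /T3free_arc T3free_G x y z.
have T3 (u v w : G) : arc u v -> arc v w -> arc u w = false.
  by move=> uv vw; exact: negbTE (T3free_G _ _ _ uv vw).
rewrite /dir_of.
case xy: (arc x y); case yx: (arc y x); case yz: (arc y z); case zy: (arc z y);
case xz: (arc x z); case zx: (arc z x) => //;
by [rewrite (T3 x y z) in xz|rewrite (T3 x z y) in xy|rewrite (T3 y x z) in yz
   |rewrite (T3 y z x) in yx|rewrite (T3 z x y) in zy|rewrite (T3 z y x) in zx].
Qed.

(** * The sum of squares *)

Section TupleSums.
Variable V : finType.
Implicit Type F : V -> V -> V -> V -> Z.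

Definition tot F : Z := \sum_a \sum_b \sum_c \sum_e F a b c e.

Lemma eq_tot F F' : (forall a b c e, F a b c e = F' a b c e) -> tot F = tot F'.
Proof.
move=> eqF; apply: eq_bigr => a _; apply: eq_bigr => b _; apply: eq_bigr => c _.
by apply: eq_bigr.
Qed.

Lemma ler_tot F F' : (forall a b c e, F a b c e <= F' a b c e) -> tot F <= tot F'.
Proof. by move=> leF; do 4! apply: ler_sum => ? _. Qed.

Lemma totD F F' : tot (fun a b c e => F a b c e + F' a b c e) = tot F + tot F'.
Proof.
rewrite /tot -big_split; apply: eq_bigr => a _; rewrite -big_split.
apply: eq_bigr => b _; rewrite -big_split.
by apply: eq_bigr => c _; rewrite -big_split.
Qed.

Lemma totB F F' : tot (fun a b c e => F a b c e - F' a b c e) = tot F - tot F'.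
Proof.
rewrite /tot -sumrB; apply: eq_bigr => a _; rewrite -sumrB.
apply: eq_bigr => b _; rewrite -sumrB.
by apply: eq_bigr => c _; rewrite -sumrB.
Qed.

Lemma totZ k F : tot (fun a b c e => k * F a b c e) = k * tot F.
Proof. by rewrite /tot; do 4! (rewrite mulr_sumr; apply: eq_bigr => ? _). Qed.

Lemma tot_swap12 F : tot (fun a b c e => F b a c e) = tot F.
Proof. by rewrite /tot exchange_big. Qed.

Lemma tot_swap23 F : tot (fun a b c e => F a c b e) = tot F.
Proof. by apply: eq_bigr => a _; rewrite exchange_big. Qed.

Lemma tot_swap34 F : tot (fun a b c e => F a b e c) = tot F.
Proof. by apply: eq_bigr => a _; apply: eq_bigr => b _; rewrite exchange_big. Qed.

Lemma tot_swap13 F : tot (fun a b c e => F c b a e) = tot F.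
Proof.
by rewrite -tot_swap12 -tot_swap23 -[RHS]tot_swap12.
Qed.

Lemma tot_swap24 F : tot (fun a b c e => F a e c b) = tot F.
Proof. by rewrite -tot_swap34 -tot_swap23 -[RHS]tot_swap34. Qed.

Lemma tot_swap14 F : tot (fun a b c e => F e b c a) = tot F.
Proof. by rewrite -tot_swap34 -tot_swap13 -[RHS]tot_swap34. Qed.

(** The sum over the symmetric group of degree 4, factored through the coset
    representatives of each [S_k] in [S_(k+1)]: every factor only involves
    transpositions. *)
Definition sym2 F a b c e : Z := F a b c e + F b a c e.
Definition sym3 F a b c e : Z := F a b c e + F c b a e + F a c b e.
Definition sym4 F a b c e : Z := F a b c e + F e b c a + F a e c b + F a b e c.
Definition sym F : V -> V -> V -> V -> Z := sym4 (sym3 (sym2 F)).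

Lemma tot_sym F : tot (sym F) = 24%:R * tot F.
Proof.
have tot2 F' : tot (sym2 F') = 2%:R * tot F'.
  by rewrite totD (tot_swap12 F'); lia.
have tot3 F' : tot (sym3 F') = 3%:R * tot F'.
  by rewrite !totD (tot_swap13 F') (tot_swap23 F'); lia.
have tot4 F' : tot (sym4 F') = 4%:R * tot F'.
  by rewrite !totD (tot_swap14 F') (tot_swap24 F') (tot_swap34 F'); lia.
by rewrite tot4 tot3 tot2; lia.
Qed.

Lemma tot_cst k : tot (fun _ _ _ _ => k) = (#|V| ^ 4)%N%:R * k.
Proof.
rewrite /tot !sumr_const cardT -cardE -!mulrnA mulr_natl; congr (_ *+ _).
Qed.

End TupleSums.

Definition is_path4 (T : Type) (d : T -> T -> dir) (a b c e : T) : bool :=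
  [&& d a b == To, d b c == To, d c e == To,
      d a c == Apart, d a e == Apart & d b e == Apart].

(** A square is a weight together with a linear form in the unknown numbers of
    vertices [v] with given codes towards [a] and [b]; a form is stored as the
    function of these two codes that returns its coefficients. *)
Definition square := (Z * (dir -> dir -> Z))%type.

Definition ind (b : bool) : Z := if b then 1 else 0.

(** Every form sums to zero over the vertices of a balanced blow-up of [C5], for
    every pair of vertices with the given code; this leaves a small space of
    forms, and the weights solve a semidefinite program on it.

    For an arc [a -> b], the first form is three times the number of vertices,
    minus fifteen times the size of the class that avoids [a] and [b], minus five
    times the number of cyclic triangles on the arc. The third form [u] is the
    in-degree of [b] minus the out-degree of [a], the fourth form [w] is the
    out-degree of [b] minus the in-degree of [a], and the second one is [u + w];
    together they make up [45 (11 u ^ 2 + 8 u w + 41 w ^ 2)].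

    For [a] and [b] not adjacent, the first form is five times the number of
    common in- or out-neighbours plus ten times the number of paths of length two
    between [a] and [b], minus twice the number of vertices. The other forms
    compare vertex sets of equal size in the blow-up, which are exchanged when all
    arcs are reversed and [a] and [b] are swapped. *)
Definition squares (r : dir) : seq square :=
  match r with
  | To => [::
      (1, fun p q => 3 - (if (p == Apart) && (q == Apart) then 15 else 0)
                       - (if (p == To) && (q == From) then 5 else 0));
      (45 * 4, fun p q => ind (q == To) - ind (p == From)
                          + ind (q == From) - ind (p == To));
      (45 * 7, fun p q => ind (q == To) - ind (p == From));
      (45 * 37, fun p q => ind (q == From) - ind (p == To))]
  | From => [::]
  | Apart => [::
      (18, fun p q => (if (p == q) && (p != Apart) then 5 else 0)
           + (if [&& p != q, p != Apart & q != Apart] then 10 else 0) - 2);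
      (18 * 30, fun p q => ind ((p == To) && (q == To))
                           - ind ((p == From) && (q == From)));
      (18 * 20, fun p q => ind ((p == To) && (q == Apart))
                           - ind ((p == Apart) && (q == From)));
      (18 * 20, fun p q => ind ((p == Apart) && (q == To))
                           - ind ((p == From) && (q == Apart)))]
  end.

Definition quadratic (s : seq square) (p q p' q' : dir) : Z :=
  foldr (fun cl acc => cl.1 * (cl.2 p q * cl.2 p' q') + acc) 0 s.

(** Summing the products of two coefficients over all pairs of vertices gives
    the square of the sum of the coefficients. *)
Lemma sum_quadratic_ge0 (V : finType) (s : seq square) (p q : V -> dir) :
  (forall cl, List.In cl s -> 0 <= cl.1) ->
  0 <= \sum_v \sum_w quadratic s (p v) (q v) (p w) (q w).
Proof.
elim: s => [|[c l] s IHs] /= c_ge0.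
  by rewrite big1 // => v _; rewrite big1.
have -> : \sum_v \sum_w (c * (l (p v) (q v) * l (p w) (q w))
                        + quadratic s (p v) (q v) (p w) (q w)) =
  c * ((\sum_v l (p v) (q v)) * (\sum_w l (p w) (q w)))
  + \sum_v \sum_w quadratic s (p v) (q v) (p w) (q w).
  rewrite big_distrlr /= mulr_sumr -big_split; apply: eq_bigr => v _.
  by rewrite mulr_sumr -big_split.
apply: addr_ge0; last by apply: IHs => cl cls; apply: c_ge0; right.
apply: mulr_ge0; first by apply: (c_ge0 (c, l)); left.
by rewrite -expr2 sqr_ge0.
Qed.

Lemma squares_ge0 r cl : List.In cl (squares r) -> 0 <= cl.1.
Proof. by case: r => [[]|] /=; do ?case=> [<- //|]. Qed.

(** In a blow-up of [C5] with [a] in class 0 and [b] in class 1, the codes [p]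
    and [q] from a vertex to [a] and to [b] determine the class of that vertex.
    The codes that occur in no blow-up get the label 3; such a vertex forms
    misplaced pairs with [a] and with [b]. *)
Definition label (p q : dir) : C5 :=
  match p, q with
  | Apart, To => @Ordinal 5 0 isT
  | From, Apart => @Ordinal 5 1 isT
  | Apart, From => @Ordinal 5 2 isT
  | To, Apart => @Ordinal 5 4 isT
  | _, _ => @Ordinal 5 3 isT
  end.

Definition misfit (T : Type) (d : T -> T -> dir) (a b v w : T) : bool :=
  (d a b == To) &&
  (d v w != dir_of (label (d v a) (d v b)) (label (d w a) (d w b))).

Definition local_slack (T : Type) (d : T -> T -> dir) (a b v w : T) : Z :=
  72 - (if is_path4 d a b v w then 9000 else 0)
     - quadratic (squares (d a b)) (d v a) (d v b) (d w a) (d w b).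

(** The contribution of a quadruple only depends on the adjacencies in it, and
    every [T3]-free graph on four vertices is tested. It is zero on the subgraphs
    of the blow-ups of [C5], which is what makes the bound sharp, and positive on
    all the others; 2160 is its least value in the presence of a misfit. *)
Lemma sym_local_slack (V : finType) (d : V -> V -> dir) a b v w :
  (forall x y, d y x = flip (d x y)) ->
  (forall x y z, tri_ok (d x y) (d y z) (d x z)) ->
  (if misfit d a b v w then 2160 else 0) <= sym (local_slack d) a b v w.
Proof.
move=> dC d3; move: (d3 a b v) (d3 a b w) (d3 a v w) (d3 b v w).
rewrite /sym /sym4 /sym3 /sym2 /local_slack /misfit /is_path4.
rewrite (dC a b) (dC a v) (dC a w) (dC b v) (dC b w) (dC v w).
move: (d a b) (d a v) (d a w) (d b v) (d b w) (d v w) => rab rav raw rbv rbw rvw.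
move=> t1 t2 t3 t4; move: t1; apply/implyP; move: t2; apply/implyP.
move: t3; apply/implyP; move: t4; apply/implyP; move: rvw; apply: all_dirP.
move: rbw; apply: all_dirP; move: rbv; apply: all_dirP; move: raw.
apply: all_dirP; move: rav; apply: all_dirP; move: rab; apply: all_dirP.
(* Once [==>] is unfolded to a conditional, the codes that are not [T3]-free
   are discarded before the weights get evaluated. *)
by rewrite /implb; vm_compute.
Qed.
Definition path4s (G : ograph) : nat :=
  (\sum_(a : G) \sum_(b : G) \sum_(c : G) \sum_(e : G)
     is_path4 (@dir_of G) a b c e)%N.

Definition misfits (G : ograph) (a b : G) : nat :=
  (\sum_(v : G) \sum_(w : G) misfit (@dir_of G) a b v w)%N.

Lemma tot_if (V : finType) (P : V -> V -> V -> V -> bool) (k : Z) :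
  tot (fun a b c e => if P a b c e then k else 0) =
  k * (\sum_a \sum_b \sum_c \sum_e P a b c e)%N%:R.
Proof.
rewrite -(@eq_tot _ (fun a b c e => k * (P a b c e)%:R)); last first.
  by move=> a b c e; case: (P a b c e); rewrite ?mulr1 ?mulr0.
rewrite totZ /tot; congr (k * _); rewrite natr_sum; apply: eq_bigr => a _.
rewrite natr_sum; apply: eq_bigr => b _; rewrite natr_sum.
by apply: eq_bigr => c _; rewrite natr_sum.
Qed.

(** The sum of the local inequalities over all quadruples. The ratio 2160 to
    [24 * 72] of the least local slack to the constant term is [5 / 4]. *)
Lemma path4_misfit_bound (G : ograph) : T3free G ->
  (5 * (\sum_(a : G) \sum_(b : G) misfits a b) + 500 * path4s G
     <= 4 * #|G| ^ 4)%N.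
Proof.
move=> /T3free_tri_ok triG.
pose d := @dir_of G.
pose Q a b v w := quadratic (squares (d a b)) (d v a) (d v b) (d w a) (d w b).
have Q_ge0 : 0 <= tot Q.
  apply: sumr_ge0 => a _; apply: sumr_ge0 => b _.
  exact: sum_quadratic_ge0 (@squares_ge0 _).
have slackE : tot (local_slack d) =
    (#|G| ^ 4)%N%:R * 72 - 9000 * (path4s G)%:R - tot Q.
  by rewrite -tot_cst -tot_if -2!totB.
have := @ler_tot _ _ _ (fun a b v w => sym_local_slack a b v w (@dir_ofC G) triG).
rewrite tot_if tot_sym slackE.
rewrite -/(path4s G) => le_slack; rewrite /misfits.
set M := (\sum_(a : G) _)%N in le_slack *.
move: (tot Q) (path4s G) M (#|G| ^ 4)%N Q_ge0 le_slack => q P M N.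
lia.
Qed.
(** * Graphs close to a blow-up of C5 *)

Section Labelling.
Variables (G : ograph) (c : G -> C5).
Implicit Types (v w x y : G) (i j : C5).

Definition label_dir v w : dir := dir_of (c v) (c w).

Definition misplaced v w : bool := dir_of v w != label_dir v w.

Definition misplaced_verts : {set G} := [set v | [exists w, misplaced v w]]%SET.

Definition quadruples (P : G -> G -> G -> G -> bool) : {set G * G * G * G} :=
  [set t | P t.1.1.1 t.1.1.2 t.1.2 t.2]%SET.

Lemma misplacedC v w : misplaced v w = misplaced w v.
Proof.
rewrite /misplaced /label_dir (dir_ofC w v) (dir_ofC (c w)).
by case: (dir_of w v) (dir_of (c w) (c v)) => [[]|] [[]|].
Qed.

Lemma misplaced_vertsP v w : misplaced v w ->
  (v \in misplaced_verts) && (w \in misplaced_verts).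
Proof.
move=> vw; rewrite !inE; apply/andP; split; apply/existsP.
  by exists w.
by exists v; rewrite misplacedC.
Qed.

Lemma card_misplaced_verts :
  (#|misplaced_verts| <= \sum_v \sum_w misplaced v w)%N.
Proof.
rewrite -sum1_card big_mkcond; apply: leq_sum => v _; rewrite inE.
by case: existsP => //= -[w vw]; rewrite (bigD1 w) //= vw.
Qed.

Lemma label_dir_placed v w : ~~ misplaced v w -> dir_of v w = label_dir v w.
Proof. by rewrite negbK => /eqP. Qed.

(** This is why a single misplaced pair creates no path. The values [To] and
    [Apart] are the codes of the six pairs of a path, and the sum counts those
    that the labels get wrong; all quadruples of labels are tested. *)
Lemma path4_labels (l1 l2 l3 l4 : C5) :
  (addn (To != dir_of l1 l2) (addn (To != dir_of l2 l3) (addn (To != dir_of l3 l4)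
   (addn (Apart != dir_of l1 l3) (addn (Apart != dir_of l1 l4)
    (Apart != dir_of l2 l4))))) <= 1)%N ->
  is_path4 (@dir_of C5) l1 l2 l3 l4.
Proof.
apply/implyP; move: l4; apply: all_C5P; move: l3; apply: all_C5P.
move: l2; apply: all_C5P; move: l1; apply: all_C5P.
by vm_compute.
Qed.

Definition crowded a b x y : bool :=
  let U := misplaced_verts in
  [|| [&& a \in U, b \in U & x \in U], [&& a \in U, b \in U & y \in U],
      [&& a \in U, x \in U & y \in U] | [&& b \in U, x \in U & y \in U]].

(** A quadruple that is not crowded contains at most one misplaced pair. *)
Lemma path4_uncrowded a b x y : is_path4 (@dir_of G) a b x y ->
  ~~ crowded a b x y -> is_path4 label_dir a b x y.
Proof.
case/and5P=> /eqP ab /eqP bx /eqP xy /eqP ax /andP[/eqP ay /eqP bY] ncr.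
apply: path4_labels.
have := @misplaced_vertsP a b; have := @misplaced_vertsP b x.
have := @misplaced_vertsP x y; have := @misplaced_vertsP a x.
have := @misplaced_vertsP a y; have := @misplaced_vertsP b y.
rewrite /misplaced ab bx xy ax ay bY /label_dir.
move=> /implyP h1 /implyP h2 /implyP h3 /implyP h4 /implyP h5 /implyP h6.
move: ncr h1 h2 h3 h4 h5 h6; rewrite /crowded.
case: (a \in _); case: (b \in _); case: (x \in _); case: (y \in _) => //= _;
by do 6! case: (_ != dir_of _ _).
Qed.

Lemma card_crowded :
  (#|quadruples crowded| <= 4 * (#|misplaced_verts| ^ 3 * #|G|))%N.
Proof.
have [U defU] : {U | U = misplaced_verts} by exists misplaced_verts.
have sub : quadruples crowded \subset
   ([set t | [&& t.1.1.1 \in U, t.1.1.2 \in U & t.1.2 \in U]]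
   :|: [set t | [&& t.1.1.1 \in U, t.1.1.2 \in U & t.2 \in U]]
   :|: [set t | [&& t.1.1.1 \in U, t.1.2 \in U & t.2 \in U]]
   :|: [set t | [&& t.1.1.2 \in U, t.1.2 \in U & t.2 \in U]])%SET.
  by apply/fintype.subsetP => t; rewrite inE /crowded -defU => tU; rewrite !inE -!orbA.
apply: leq_trans (subset_leq_card sub) _; rewrite -defU.
have le_setX (A B C D : {set G}) (S : {set G * G * G * G}) :
    S = finset.setX (finset.setX (finset.setX A B) C) D ->
    (#|A| * #|B| * #|C| * #|D| <= #|U| ^ 3 * #|G|)%N ->
    (#|S| <= #|U| ^ 3 * #|G|)%N.
  by move=> ->; rewrite !cardsX.
have -> : (4 * (#|U| ^ 3 * #|G|) = #|U| ^ 3 * #|G| + #|U| ^ 3 * #|G|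
             + #|U| ^ 3 * #|G| + #|U| ^ 3 * #|G|)%N by lia.
have leU (A B : {set G * G * G * G}) (m p : nat) :
    (#|A| <= m)%N -> (#|B| <= p)%N -> (#|A :|: B|%SET <= m + p)%N.
  by move=> Am Bp; apply: leq_trans (leq_card_setU _ _) (leq_add Am Bp).
apply: (leU _ _ _ _ (leU _ _ _ _ (leU _ _ _ _ _ _) _) _).
- apply: (@le_setX U U U [set: G]%SET).
    by apply/setP => -[[[a b] x] y]; rewrite !inE /= andbT andbA.
  by rewrite cardsT; lia.
- apply: (@le_setX U U [set: G]%SET U).
    by apply/setP => -[[[a b] x] y]; rewrite !inE /= andbT andbA.
  by rewrite cardsT; lia.
- apply: (@le_setX U [set: G]%SET U U).
    by apply/setP => -[[[a b] x] y]; rewrite !inE /= andbT andbA.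
  by rewrite cardsT; lia.
- apply: (@le_setX [set: G]%SET U U U).
    by apply/setP => -[[[a b] x] y]; rewrite !inE /= andbA.
  by rewrite cardsT; lia.
Qed.

Lemma card_quadruples P : #|quadruples P| = (\sum_a \sum_b \sum_x \sum_y P a b x y)%N.
Proof.
rewrite -sum1_card big_mkcond pair_bigA pair_bigA pair_bigA /=.
by apply: eq_bigr => t _; rewrite inE; case: (P _ _ _ _).
Qed.

(** Apart from the crowded quadruples, the paths of [G] are among those of the
    blow-up, and the latter include the quadruples of [L], which [G] misses. *)
Lemma path4s_loss (L : {set G * G * G * G}) :
  {in L, forall t, [/\ is_path4 label_dir t.1.1.1 t.1.1.2 t.1.2 t.2,
     ~~ is_path4 (@dir_of G) t.1.1.1 t.1.1.2 t.1.2 t.2 &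
     ~~ crowded t.1.1.1 t.1.1.2 t.1.2 t.2]} ->
  (path4s G + #|L| <= #|quadruples (is_path4 label_dir)|
                      + 4 * (#|misplaced_verts| ^ 3 * #|G|))%N.
Proof.
move=> LP.
have sub : quadruples (is_path4 (@dir_of G)) \subset
    ((quadruples (is_path4 label_dir) :\: L) :|: quadruples crowded)%SET.
  apply/fintype.subsetP => t tP; rewrite finset.in_setU finset.in_setD.
  case: (boolP (t \in quadruples crowded)) => [_|ncr]; rewrite ?orbT // orbF.
  move: tP ncr; rewrite !inE => tP ncr; rewrite path4_uncrowded // andbT.
  by apply/negP => /LP[_ /negP].
have subL : (L \subset quadruples (is_path4 label_dir))%SET.
  by apply/fintype.subsetP => t /LP[tP _ _]; rewrite inE.
have := leq_trans (subset_leq_card sub) (leq_card_setU _ _).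
have := cardsID L (quadruples (is_path4 label_dir)); rewrite (finset.setIidPr subL).
rewrite [path4s G](esym (card_quadruples _)); have := card_crowded; lia.
Qed.

Definition next_label i : C5 := @Ordinal 5 (i.+1 %% 5) (ltn_pmod i.+1 (isT : (0 < 5)%N)).

(** The vertices of a class all of whose adjacencies are as in the blow-up. *)
Definition core i : {set G} := [set x | (c x == i) && (x \notin misplaced_verts)]%SET.

Lemma core_placed i x v : x \in core i -> dir_of x v = dir_of i (c v).
Proof.
rewrite inE => /andP[/eqP <- xU]; apply: label_dir_placed.
by apply: contra xU => /misplaced_vertsP/andP[].
Qed.

Lemma core_notU i x : x \in core i -> (x \in misplaced_verts) = false.
Proof. by rewrite inE => /andP[_ /negbTE]. Qed.

Lemma core_label i x : x \in core i -> c x = i.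
Proof. by rewrite inE => /andP[/eqP]. Qed.

Lemma path4_next i :
  is_path4 (@dir_of C5) i (next_label i) (next_label (next_label i))
    (next_label (next_label (next_label i))).
Proof. by move: i; apply: all_C5P; vm_compute. Qed.

(** A misplaced pair spoils every path of the blow-up that it takes part in. Two
    vertices with consecutive labels are the beginning of such a path, whose
    other two vertices may be chosen freely in their classes. *)
Lemma misplaced_adj_loss v w : misplaced v w -> c w = next_label (c v) ->
  (path4s G + #|core (next_label (c w))| * #|core (next_label (next_label (c w)))|
   <= #|quadruples (is_path4 label_dir)| + 4 * (#|misplaced_verts| ^ 3 * #|G|))%N.
Proof.
move=> vw cw.
have := @path4s_loss (finset.setX (finset.setX (finset.setX [set v] [set w])
  (core (next_label (c w)))) (core (next_label (next_label (c w)))))%SET.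
rewrite !cardsX !cards1 !mul1n; apply => -[[[a b] x] y].
rewrite !finset.in_setX !finset.in_set1 -!andbA => /and4P[/eqP-> /eqP-> xC yC] /=.
rewrite /crowded (core_notU xC) (core_notU yC) !andbF.
rewrite /is_path4 /label_dir (core_label xC) (core_label yC) cw.
have := path4_next (c v); rewrite /is_path4 => pth; rewrite pth; split=> //.
apply: contra vw => /andP[/eqP vw _]; rewrite vw /label_dir cw.
by case/andP: pth => /eqP ->.
Qed.

(** Labels at distance two are those of the first and third vertex of a path. *)
Lemma misplaced_skip_loss v w : misplaced v w ->
  c w = next_label (next_label (c v)) ->
  (path4s G + #|core (next_label (c v))| * #|core (next_label (c w))|
   <= #|quadruples (is_path4 label_dir)| + 4 * (#|misplaced_verts| ^ 3 * #|G|))%N.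
Proof.
move=> vw cw.
have := @path4s_loss (finset.setX (finset.setX (finset.setX [set v]
  (core (next_label (c v)))) [set w]) (core (next_label (c w))))%SET.
rewrite !cardsX !cards1 muln1 mul1n; apply => -[[[a b] x] y].
rewrite !finset.in_setX !finset.in_set1 -!andbA => /and4P[/eqP-> bC /eqP-> yC] /=.
rewrite /crowded (core_notU bC) (core_notU yC) ?andbF.
rewrite /is_path4 /label_dir (core_label bC) (core_label yC) cw.
have := path4_next (c v); rewrite /is_path4 => pth; rewrite pth; split=> //.
apply: contra vw => /and5P[_ _ _ /eqP vw _]; rewrite vw /label_dir cw.
by case/and5P: pth => _ _ _ /eqP ->.
Qed.

(** Two distinct labels are consecutive or at distance two, in one order or the
    other. Two misplaced vertices with the same label are adjacent, hence form a
    transitive triangle with any vertex of the core of the previous class. *)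
Lemma misplaced_loss m : T3free G ->
  (0 < m)%N -> (forall i, (m <= #|core i|)%N) ->
  forall v w, misplaced v w ->
  (path4s G + m ^ 2
   <= #|quadruples (is_path4 label_dir)| + 4 * (#|misplaced_verts| ^ 3 * #|G|))%N.
Proof.
move=> T3G m_gt0 m_le v w vw.
have m2 i j : (m ^ 2 <= #|core i| * #|core j|)%N by rewrite -mulnn leq_mul.
have [cvw|/eqP cvw] := eqVneq (c v) (c w).
  have [i ic] : exists i, dir_of i (c v) = To.
    by exists (next_label (next_label (next_label (next_label (c v)))));
      apply/eqP; move: (c v); apply: all_C5P; vm_compute.
  have /card_gt0P[u uC] : (0 < #|core i|)%N by apply: leq_trans (m_le i).
  have uv : arc u v by rewrite -dir_of_To (core_placed _ uC) ic.
  have uw : arc u w by rewrite -dir_of_To (core_placed _ uC) -cvw ic.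
  have T3 := T3free_arc T3G; case/negP: vw; rewrite /label_dir cvw dir_ofxx.
  rewrite /dir_of; case: ifP => [vw|_]; first by have := T3 _ _ _ uv vw; rewrite uw.
  by case: ifP => // wv; have := T3 _ _ _ uw wv; rewrite uv.
have : [|| c w == next_label (c v), c w == next_label (next_label (c v)),
           c v == next_label (c w) | c v == next_label (next_label (c w))].
  move/eqP: cvw; apply/implyP; move: (c v); apply: all_C5P; move: (c w).
  by apply: all_C5P; vm_compute.
case/or4P=> /eqP cE.
- by apply: leq_trans (misplaced_adj_loss vw cE); rewrite leq_add2l.
- by apply: leq_trans (misplaced_skip_loss vw cE); rewrite leq_add2l.
- by apply: leq_trans (misplaced_adj_loss _ cE); rewrite ?leq_add2l // misplacedC.
- by apply: leq_trans (misplaced_skip_loss _ cE); rewrite ?leq_add2l // misplacedC.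
Qed.

End Labelling.

(** * Maximizing the number of paths in a blow-up *)

(** The number of induced directed paths on four vertices in a blow-up of [C5]
    whose classes have sizes [a], [b], [c], [d], [e]: such a path misses
    exactly one class. *)
Definition e4 (a b c d e : nat) : nat :=
  (a * b * c * d + b * c * d * e + c * d * e * a + d * e * a * b
   + e * a * b * c)%N.

Definition e4max (n : nat) : nat :=
  e4 (n %/ 5) ((n + 1) %/ 5) ((n + 2) %/ 5) ((n + 3) %/ 5) ((n + 4) %/ 5).

Lemma e4_pair a b c d e :
  e4 a b c d e = (a * b * (c * d + d * e + c * e) + (a + b) * (c * d * e))%N.
Proof. rewrite /e4; ring. Qed.

(** Moving one vertex from a class of size [a] to one of size [b] keeps [a + b] and
    increases [a * b]; the products in which [a * b] occurs do not all vanish, for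
    at most one class is empty. *)
Lemma e4_smooth a b c d e : (b.+1 < a)%N -> (0 < e4 a b c d e)%N ->
  (e4 a b c d e < e4 a.-1 b.+1 c d e)%N.
Proof.
move=> ba; rewrite !e4_pair; have [k ->] : exists k, a = (b + k).+2.
  by exists (a - b.+2)%N; lia.
set S := (c * d + d * e + c * e)%N; set R := (c * d * e)%N => /= e4_gt0.
have S_gt0 : (0 < S)%N.
  rewrite lt0n; apply: contraTneq e4_gt0 => S0.
  have : (c * d = 0)%N by move: S0; rewrite /S; lia.
  by rewrite /R S0 => ->; rewrite mul0n !muln0.
have -> : ((b + k).+1 * b.+1 * S = (b + k).+2 * b * S + k.+1 * S)%N by ring.
by nia.
Qed.

(* Reorders the five sizes so that [x] and [y] come first if [x] exceeds [y] by
   two or more, and otherwise records that it does not. *)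
Ltac compare_sizes x y r s t :=
  case: (ltnP y.+1 x) => ?;
    [by left; exists x, y, r, s, t; split=> //; rewrite /e4; ring|].

Lemma e4_spread a b c d e :
  (exists x y r s t,
     [/\ e4 a b c d e = e4 x y r s t, (a + b + c + d + e = x + y + r + s + t)%N,
         (a * a + b * b + c * c + d * d + e * e
          = x * x + y * y + r * r + s * s + t * t)%N & (y.+1 < x)%N]) \/
  [/\ [/\ a <= b.+1, a <= c.+1, a <= d.+1 & a <= e.+1],
      [/\ b <= a.+1, b <= c.+1, b <= d.+1 & b <= e.+1],
      [/\ c <= a.+1, c <= b.+1, c <= d.+1 & c <= e.+1],
      [/\ d <= a.+1, d <= b.+1, d <= c.+1 & d <= e.+1] &
      [/\ e <= a.+1, e <= b.+1, e <= c.+1 & e <= d.+1]]%N.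
Proof.
compare_sizes a b c d e; compare_sizes a c b d e; compare_sizes a d b c e.
compare_sizes a e b c d; compare_sizes b a c d e; compare_sizes b c a d e.
compare_sizes b d a c e; compare_sizes b e a c d; compare_sizes c a b d e.
compare_sizes c b a d e; compare_sizes c d a b e; compare_sizes c e a b d.
compare_sizes d a b c e; compare_sizes d b a c e; compare_sizes d c a b e.
compare_sizes d e a b c; compare_sizes e a b c d; compare_sizes e b a c d.
compare_sizes e c a b d; compare_sizes e d a b c.
by right; split; split.
Qed.

Definition balanced_size (n k : nat) : Prop := k = (n %/ 5)%N \/ k = ((n + 4) %/ 5)%N.

Lemma quotients5 n : exists q r, [/\ (n = q * 5 + r)%N, (r < 5)%N, (n %/ 5 = q)%N &
  [/\ (n + 1) %/ 5 = q + (3 < r), (n + 2) %/ 5 = q + (2 < r),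
      (n + 3) %/ 5 = q + (1 < r) & (n + 4) %/ 5 = q + (0 < r)]]%N.
Proof.
exists (n %/ 5)%N, (n %% 5)%N; split=> //; [exact: divn_eq|exact: ltn_pmod|].
by split; lia.
Qed.

Lemma e4_balanced a b c d e n : (a + b + c + d + e = n)%N ->
  balanced_size n a -> balanced_size n b -> balanced_size n c ->
  balanced_size n d -> balanced_size n e -> e4 a b c d e = e4max n.
Proof.
rewrite /balanced_size /e4max => sum_n.
have [q [r [nE r5 -> [-> -> -> ->]]]] := quotients5 n.
case: r r5 nE => [|[|[|[|[|//]]]]] _ nE; rewrite ?addn0 ?addn1.
- by do 5! case=> ->.
- by do 5! case=> ?; subst; try lia; rewrite /e4; ring.
- by do 5! case=> ?; subst; try lia; rewrite /e4; ring.
- by do 5! case=> ?; subst; try lia; rewrite /e4; ring.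
- by do 5! case=> ?; subst; try lia; rewrite /e4; ring.
Qed.

Lemma e4_close_balanced a b c d e n : (a + b + c + d + e = n)%N ->
  [/\ [/\ a <= b.+1, a <= c.+1, a <= d.+1 & a <= e.+1],
      [/\ b <= a.+1, b <= c.+1, b <= d.+1 & b <= e.+1],
      [/\ c <= a.+1, c <= b.+1, c <= d.+1 & c <= e.+1],
      [/\ d <= a.+1, d <= b.+1, d <= c.+1 & d <= e.+1] &
      [/\ e <= a.+1, e <= b.+1, e <= c.+1 & e <= d.+1]]%N ->
  [/\ balanced_size n a, balanced_size n b, balanced_size n c,
      balanced_size n d & balanced_size n e].
Proof.
by rewrite /balanced_size => <- [[? ? ? ?] [? ? ? ?] [? ? ? ?] [? ? ? ?] [? ? ? ?]];
  split; lia.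
Qed.

(** Smoothing decreases the sum of the squares of the sizes, so it stops, and it
    can only stop at sizes that differ by at most one. *)
Lemma e4_le_max a b c d e n : (a + b + c + d + e = n)%N ->
  (e4 a b c d e <= e4max n)%N.
Proof.
have [m] := ubnP (a * a + b * b + c * c + d * d + e * e)%N.
elim: m a b c d e => // m IHm a b c d e sq_lt sum_n.
case: (posnP (e4 a b c d e)) => [-> //|e4_gt0].
case: (e4_spread a b c d e) => [|close]; last first.
  by have [? ? ? ? ?] := e4_close_balanced sum_n close; rewrite (@e4_balanced _ _ _ _ _ n).
move=> [x [y [r [s [t [e4E sumE sqE yx]]]]]]; move: e4_gt0; rewrite e4E => e4_gt0.
apply: leq_trans (ltnW (e4_smooth yx e4_gt0)) _; apply: IHm; last by lia.
have [k xE] : exists k, x = (y + k).+2 by exists (x - y.+2)%N; lia.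
by move: sq_lt; rewrite sqE xE /=; nia.
Qed.

Lemma e4_eq_max a b c d e n : (a + b + c + d + e = n)%N ->
  (0 < e4 a b c d e)%N -> (e4max n <= e4 a b c d e)%N ->
  [/\ balanced_size n a, balanced_size n b, balanced_size n c,
      balanced_size n d & balanced_size n e].
Proof.
move=> sum_n e4_gt0; case: (e4_spread a b c d e) => [|close _]; last first.
  exact: e4_close_balanced sum_n close.
move=> [x [y [r [s [t [e4E sumE _ yx]]]]]]; move: e4_gt0; rewrite e4E => e4_gt0.
rewrite leqNgt (leq_trans (e4_smooth yx e4_gt0)) //.
by apply: e4_le_max; lia.
Qed.

(** If [n = 5 q + r], then [125 * e4max n] has the same terms in [q ^ 4] and
    [q ^ 3] as [n ^ 4], because every class lies in four of the five products. *)
Lemma e4max_lower n : (n ^ 4 <= 125 * e4max n + 16 * n ^ 2)%N.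
Proof.
rewrite /e4max; have [q [r [-> r5 -> [-> -> -> ->]]]] := quotients5 n.
by case: r r5 => [|[|[|[|[|//]]]]] _; rewrite /= ?addn0 ?addn1 /e4; nia.
Qed.

Lemma e4max_dvd n : (5 %| n)%N -> (125 * e4max n = n ^ 4)%N.
Proof.
rewrite /dvdn /e4max; have [q [r [-> r5 -> [-> -> -> ->]]]] := quotients5 n.
by case: r r5 => [|[|[|[|[|//]]]]] _ dvd5; rewrite /= ?addn0 /e4; lia.
Qed.

(** * Near-extremal graphs are blow-ups *)

Section BlowupCount.
Variables (G : ograph) (c : G -> C5).

Definition class (i : C5) : {set G} := [set x | c x == i]%SET.

Lemma is_path4_C5 (i j k l : C5) : is_path4 (@dir_of C5) i j k l =
  [&& j == next_label i, k == next_label (next_label i)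
    & l == next_label (next_label (next_label i))].
Proof.
apply/eqP; move: l; apply: all_C5P; move: k; apply: all_C5P.
by move: j; apply: all_C5P; move: i; apply: all_C5P; vm_compute.
Qed.

Definition C5_0 : C5 := @Ordinal 5 0 isT.
Definition C5_1 : C5 := @Ordinal 5 1 isT.
Definition C5_2 : C5 := @Ordinal 5 2 isT.
Definition C5_3 : C5 := @Ordinal 5 3 isT.
Definition C5_4 : C5 := @Ordinal 5 4 isT.

Lemma sum_C5 (f : C5 -> nat) :
  (\sum_i f i = f C5_0 + f C5_1 + f C5_2 + f C5_3 + f C5_4)%N.
Proof.
rewrite (_ : \sum_i f i = \sum_(i < 5) f i)%N // !big_ord_recl big_ord0 addn0 !addnA.
by congr (_ + _ + _ + _ + _)%N; congr f; apply: val_inj.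
Qed.

Lemma sum_class : (#|class C5_0| + #|class C5_1| + #|class C5_2| + #|class C5_3|
  + #|class C5_4| = #|G|)%N.
Proof.
rewrite -(sum_C5 (fun i => #|class i|)) -sum1_card (partition_big c predT) //=.
by apply: eq_bigr => i _; rewrite -sum1_card; apply: eq_bigl => x; rewrite inE.
Qed.

Lemma card_blowup_path4s : #|quadruples (is_path4 (label_dir c))| =
  e4 #|class C5_0| #|class C5_1| #|class C5_2| #|class C5_3| #|class C5_4|.
Proof.
have sum_eq j : (\sum_x (c x == j) = #|class j|)%N.
  rewrite -sum1_card [RHS]big_mkcond.
  by apply: eq_bigr => x _; rewrite inE; case: (_ == _).
pose y i := #|class i|.
pose f i := (y i * (y (next_label i) * (y (next_label (next_label i)) *
                y (next_label (next_label (next_label i))))))%N.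
transitivity (\sum_i f i)%N; last first.
  rewrite sum_C5 /f /y.
  have n0 : next_label C5_0 = C5_1 by apply: val_inj.
  have n1 : next_label C5_1 = C5_2 by apply: val_inj.
  have n2 : next_label C5_2 = C5_3 by apply: val_inj.
  have n3 : next_label C5_3 = C5_4 by apply: val_inj.
  have n4 : next_label C5_4 = C5_0 by apply: val_inj.
  by rewrite !(n0, n1, n2, n3, n4) /e4 !mulnA.
rewrite card_quadruples (partition_big c predT) //=; apply: eq_bigr => i _.
rewrite /f -[y i]sum1_card big_distrl /= [RHS]big_mkcond [LHS]big_mkcond.
apply: eq_bigr => a _; rewrite inE; case: eqP => // <-; rewrite mul1n.
rewrite /y -!sum_eq big_distrl; apply: eq_bigr => b _.
rewrite big_distrlr /= big_distrr; apply: eq_bigr => x _.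
rewrite big_distrr; apply: eq_bigr => z _.
by rewrite /= !mulnb -is_path4_C5.
Qed.

Definition properly_labelled : Prop := forall x y : G, arc x y = arc (c x) (c y).

Lemma placed_properly : (forall v w, ~~ misplaced c v w) -> properly_labelled.
Proof. by move=> placed x y; rewrite -!dir_of_To (label_dir_placed (placed x y)). Qed.

Lemma proper_dir : properly_labelled -> @dir_of G = label_dir c.
Proof.
move=> pl; apply: funext => x; apply: funext => y.
by rewrite /label_dir /dir_of !pl.
Qed.

Lemma proper_path4s : properly_labelled -> path4s G =
  e4 #|class C5_0| #|class C5_1| #|class C5_2| #|class C5_3| #|class C5_4|.
Proof. by move=> pl; rewrite -card_blowup_path4s card_quadruples /path4s proper_dir. Qed.

Lemma card_core i : (#|class i| <= #|core c i| + #|misplaced_verts c|)%N.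
Proof.
apply: leq_trans (leq_card_setU _ _); apply/subset_leq_card/fintype.subsetP => x.
by rewrite finset.in_setU !inE => -> /=; case: existsP.
Qed.

End BlowupCount.

(** A path is determined by its first and last arcs. *)
Lemma path4s_le_arcs (G : ograph) :
  (path4s G <= (\sum_(a : G) \sum_(b : G) arc a b) ^ 2)%N.
Proof.
rewrite -mulnn big_distrl /=; apply: leq_sum => a _.
rewrite big_distrl /=; apply: leq_sum => b _.
rewrite big_distrr /=; apply: leq_sum => x _.
rewrite big_distrr /=; apply: leq_sum => y _.
rewrite /is_path4 !dir_of_To; case: (arc a b) => //=.
by case: (arc x y); rewrite /= ?andbF // leq_b1.
Qed.

Lemma good_arc (G : ograph) (K : nat) : T3free G ->
  (4 * #|G| ^ 4 < 500 * path4s G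
      + 5 * (K.+1 * \sum_(a : G) \sum_(b : G) arc a b))%N ->
  exists a b : G, arc a b /\ (misfits a b <= K)%N.
Proof.
move=> T3G; have := path4_misfit_bound T3G => bound ineq.
apply: contrapT => noarc.
have : (K.+1 * \sum_(a : G) \sum_(b : G) arc a b
          <= \sum_(a : G) \sum_(b : G) misfits a b)%N.
  rewrite big_distrr; apply: leq_sum => a _; rewrite big_distrr.
  apply: leq_sum => b _ /=; case: (boolP (arc a b)); rewrite ?muln0 // muln1 => ab.
  by rewrite ltnNge; apply/negP => leK; apply: noarc; exists a, b.
lia.
Qed.

Lemma arc_labels (G : ograph) (a b : G) : arc a b ->
  exists c : G -> C5, misfits a b = (\sum_v \sum_w misplaced c v w)%N.
Proof.
rewrite -dir_of_To => /eqP ab.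
exists (fun v => label (dir_of v a) (dir_of v b)).
apply: eq_bigr => v _; apply: eq_bigr => w _.
by rewrite /misfit /misplaced /label_dir ab eqxx.
Qed.

Lemma prod4_AMGM (a b c d : nat) : (256 * (a * b * c * d) <= (a + b + c + d) ^ 4)%N.
Proof.
have am2 x y : (4 * (x * y) <= (x + y) ^ 2)%N by rewrite nat_AGM2.
have -> : (256 * (a * b * c * d) = 4 ^ 2 * ((4 * (a * b)) * (4 * (c * d))))%N by ring.
have -> : ((a + b + c + d) ^ 4 = ((a + b + (c + d)) ^ 2) ^ 2)%N by ring.
apply: leq_trans (_ : 4 ^ 2 * ((a + b) ^ 2 * (c + d) ^ 2) <= _)%N.
  by rewrite leq_mul2l leq_mul ?orbT.
by rewrite -!expnMn leq_exp2r.
Qed.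

(** A blow-up with a very small class has few paths: all but a few of them
    avoid that class, and four classes yield at most [n ^ 4 / 256] of them,
    well below [n ^ 4 / 125]. *)
Lemma e4_class_large (a b c d e n k : nat) : (a + b + c + d + e = n)%N ->
  (0 < k)%N -> (2 ^ 21 * k <= n)%N ->
  (n ^ 4 <= 125 * (e4 a b c d e + 4 * (k * n)) + 16 * n ^ 2)%N ->
  (n <= 256 * e)%N.
Proof.
move=> sum_n k_gt0 le_n le4.
have e4_le : (e4 a b c d e <= a * b * c * d + e * n ^ 3)%N.
  have -> : e4 a b c d e =
      (a * b * c * d + e * (b * c * d + c * d * a + d * a * b + a * b * c))%N.
    by rewrite /e4; ring.
  rewrite leq_add2l leq_mul2l; apply/orP; right.
  apply: leq_trans (_ : (a + b + c + d) ^ 3 <= _)%N; first by nia.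
  by rewrite leq_exp2r //; lia.
have abcd_le : (256 * (a * b * c * d) <= n ^ 4)%N.
  by apply: leq_trans (prod4_AMGM a b c d) _; rewrite leq_exp2r //; lia.
rewrite leqNgt; apply/negP => lt_n.
have e_le : (256 * (e * n ^ 3) <= n ^ 4)%N.
  by rewrite mulnA [(n ^ 4)%N]expnS leq_mul2r (ltnW lt_n) orbT.
have k_le : (2 ^ 21 * (k * n) <= n ^ 2)%N.
  by rewrite mulnA -mulnn leq_mul2r le_n orbT.
have n2_le : (2 ^ 21 * n ^ 2 <= n ^ 4)%N.
  rewrite (expnD n 2 2) leq_mul2r; apply/orP; right.
  rewrite -mulnn; apply: leq_trans (_ : 2 ^ 21 * k * n <= _)%N; first by nia.
  by rewrite leq_mul2r le_n orbT.
have n_gt0 : (0 < n ^ 4)%N by rewrite expn_gt0; apply/orP; left; lia.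
move: (n ^ 4)%N (n ^ 2)%N (k * n)%N (a * b * c * d)%N (e * n ^ 3)%N (e4 a b c d e)
  le4 e4_le abcd_le e_le k_le n2_le n_gt0 => N4 N2 kn A B C.
lia.
Qed.

(** Each class has at least [n / 256] vertices, so its core has [m >= n / 512]. A
    misplaced pair would cost [m ^ 2] paths, of order [n ^ 2], for a gain of at
    most [4 K ^ 3 n] crowded quadruples: this fails when [n >= 2 ^ 21 K ^ 3]. *)
Lemma near_extremal_placed (G : ograph) (c : G -> C5) (K : nat) :
  T3free G -> (0 < K)%N -> (2 ^ 21 * K ^ 3 <= #|G|)%N ->
  (\sum_v \sum_w misplaced c v w <= K)%N -> (e4max #|G| <= path4s G)%N ->
  forall v w, ~~ misplaced c v w.
Proof.
move=> T3G K_gt0 n_large leK max_le v w; apply/negP => vw.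
set n := #|G| in n_large max_le.
have U_le : (#|misplaced_verts c| <= K)%N.
  exact: leq_trans (card_misplaced_verts c) leK.
have k_gt0 : (0 < K ^ 3)%N by rewrite expn_gt0 K_gt0.
have K_le : (K <= K ^ 3)%N by rewrite -[X in (X <= _)%N]expn1 leq_pexp2l.
have U3_le : (#|misplaced_verts c| ^ 3 * #|G| <= K ^ 3 * n)%N.
  by rewrite leq_mul2r leq_exp2r ?U_le ?orbT.
have sum_n := sum_class c.
have := card_blowup_path4s c; set E := e4 _ _ _ _ _ => blowE.
have E_le : (E <= e4max n)%N by apply: e4_le_max.
have P_le : (path4s G <= E + 4 * (K ^ 3 * n))%N.
  have /(@path4s_loss G c) : {in finset.set0, forall t : G * G * G * G,
    [/\ is_path4 (label_dir c) t.1.1.1 t.1.1.2 t.1.2 t.2,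
      ~~ is_path4 (@dir_of G) t.1.1.1 t.1.1.2 t.1.2 t.2 &
      ~~ crowded c t.1.1.1 t.1.1.2 t.1.2 t.2]} by move=> t; rewrite inE.
  rewrite cards0 addn0 blowE; lia.
have n4_le : (n ^ 4 <= 125 * (E + 4 * (K ^ 3 * n)) + 16 * n ^ 2)%N.
  by have := e4max_lower n; lia.
have class_large i : (n <= 256 * #|class c i|)%N.
  have class_ge j1 j2 j3 j4 (j : C5) :
      (#|class c j1| + #|class c j2| + #|class c j3| + #|class c j4| + #|class c j| = n)%N ->
      E = e4 #|class c j1| #|class c j2| #|class c j3| #|class c j4| #|class c j| ->
      (n <= 256 * #|class c j|)%N.
    by move=> sum_j EE; apply: e4_class_large sum_j k_gt0 n_large _; rewrite -EE.
  have [-> | [-> | [-> | [-> | ->]]]] :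
      i = C5_0 \/ i = C5_1 \/ i = C5_2 \/ i = C5_3 \/ i = C5_4.
    by case: i => [[|[|[|[|[|//]]]]] ?]; do ?[by left; apply: val_inj | right]; apply: val_inj.
  - by apply: (class_ge C5_1 C5_2 C5_3 C5_4); [lia|rewrite /E /e4; ring].
  - by apply: (class_ge C5_0 C5_2 C5_3 C5_4); [lia|rewrite /E /e4; ring].
  - by apply: (class_ge C5_0 C5_1 C5_3 C5_4); [lia|rewrite /E /e4; ring].
  - by apply: (class_ge C5_0 C5_1 C5_2 C5_4); [lia|rewrite /E /e4; ring].
  - by apply: (class_ge C5_0 C5_1 C5_2 C5_3); [lia|rewrite /E /e4; ring].
have core_large i : (n <= 512 * #|core c i|)%N.
  by have := class_large i; have := card_core c i; lia.
have [m n_le m_le] : exists2 m, (n <= 512 * m)%N & forall i, (m <= #|core c i|)%N.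
  pose s := [arg min_(i < C5_0) #|core c i|]%N.
  exists #|core c s|; first exact: core_large.
  by move=> i; rewrite /s; case: arg_minnP => // j _; apply.
have m_gt0 : (0 < m)%N by lia.
have := misplaced_loss T3G m_gt0 m_le vw; rewrite blowE => loss.
have m2_le : (m ^ 2 <= 4 * (K ^ 3 * n))%N by lia.
have n2_le : (n ^ 2 <= 2 ^ 18 * m ^ 2)%N.
  by rewrite (expnM 2 9 2) -expnMn leq_exp2r //; lia.
have : (2 ^ 21 * (K ^ 3 * n) <= n ^ 2)%N.
  by rewrite mulnA -mulnn leq_mul2r n_large orbT.
have : (0 < K ^ 3 * n)%N by rewrite muln_gt0 k_gt0; lia.
move: (m ^ 2)%N (n ^ 2)%N (K ^ 3 * n)%N m2_le n2_le => m2 n2 kn; lia.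
Qed.

Lemma e4max_gt0 n : (0 < n)%N -> (2 ^ 21 * 153 ^ 3 <= n)%N \/ (5 %| n)%N ->
  (0 < e4max n)%N.
Proof.
move=> n_gt0 n_cond; have lower := e4max_lower n; case: n_cond => [n_large|dvd5].
  have n_ge16 : (16 < n ^ 2)%N by nia.
  have : (17 * n ^ 2 <= n ^ 4)%N by rewrite (expnD _ 2 2) leq_mul2r n_ge16 orbT.
  by have : (0 < n ^ 2)%N; [rewrite expn_gt0 n_gt0|lia].
by have := e4max_dvd dvd5; have : (0 < n ^ 4)%N; [rewrite expn_gt0 n_gt0|lia].
Qed.

(** For large [n] the total number of misfits is at most [64 n ^ 2 / 5], and the
    number of arcs, whose square is at least the number of paths, exceeds
    [n ^ 2 / 12]; hence some arc has at most 153 misfits. When 5 divides [n] there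
    are no misfits at all. *)
Lemma near_extremal_labelled (G : ograph) : T3free G -> (0 < #|G|)%N ->
  (2 ^ 21 * 153 ^ 3 <= #|G|)%N \/ (5 %| #|G|)%N ->
  (e4max #|G| <= path4s G)%N ->
  exists c : G -> C5, properly_labelled c.
Proof.
move=> T3G G_gt0 n_cond max_le.
have max_gt0 := e4max_gt0 G_gt0 n_cond.
have arcs2 := path4s_le_arcs G.
case: n_cond => [n_large|dvd5].
  have [|a [b [ab leK]]] := @good_arc G 153 T3G.
    set n := #|G| in n_large max_le *.
    set E := (\sum_a _)%N in arcs2 *.
    have lower := e4max_lower n.
    have n2 : (n ^ 2 <= 12 * E)%N.
      rewrite -leq_sqr expnMn -expnM.
      suff : (2 ^ 10 * n ^ 2 <= n ^ 4)%N by lia.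
      by rewrite (expnD n 2 2) leq_mul2r; apply/orP; right; nia.
    by have : (0 < n ^ 2)%N; [rewrite expn_gt0 G_gt0|lia].
  have [c cE] := arc_labels ab; exists c; apply: placed_properly.
  by apply: (@near_extremal_placed _ _ 153); rewrite // -cE.
have [|a [b [ab leK]]] := @good_arc G 0 T3G.
  have := e4max_dvd dvd5; set E := (\sum_a _)%N in arcs2 *.
  by have : (0 < E)%N; [rewrite lt0n; apply: contraTneq arcs2 => ->; lia|lia].
have [c cE] := arc_labels ab; exists c; apply: placed_properly => v w.
apply/negP => vw; move: leK; rewrite cE leqn0 sum_nat_eq0 => /forallP/(_ v).
by rewrite sum_nat_eq0 => /forallP/(_ w); rewrite vw.
Qed.

(** * Induced copies of the path *)

Lemma isomorphic_sym (G H : ograph) : isomorphic G H -> isomorphic H G.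
Proof.
move=> [f [g fK gK] fE]; exists g; first by exists f.
by move=> x y; rewrite -fE !gK.
Qed.

Lemma dir_of_morph (G H : ograph) (f : G -> H) :
  (forall x y, arc (f x) (f y) = arc x y) ->
  forall x y, dir_of (f x) (f y) = dir_of x y.
Proof. by move=> fE x y; rewrite /dir_of !fE. Qed.

Section InducedPaths.
Variable G : ograph.
Implicit Types (a b x y : G) (t : G * G * G * G).

Definition verts t : seq G := [:: t.1.1.1; t.1.1.2; t.1.2; t.2].

Lemma path4_dirs a b x y : is_path4 (@dir_of G) a b x y ->
  [/\ dir_of a b = To, dir_of b x = To, dir_of x y = To,
      [/\ dir_of a x = Apart, dir_of a y = Apart & dir_of b y = Apart] &
      [/\ dir_of b a = From, dir_of x b = From, dir_of y x = From,
      dir_of x a = Apart & dir_of y a = Apart /\ dir_of y b = Apart]].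
Proof.
case/and5P=> /eqP ab /eqP bx /eqP xy /eqP ax /andP[/eqP ay /eqP by'].
by rewrite (dir_ofC a b) (dir_ofC b x) (dir_ofC x y) (dir_ofC a x) (dir_ofC a y)
  (dir_ofC b y) ab bx xy ax ay by'.
Qed.

Lemma path4_uniq t : is_path4 (@dir_of G) t.1.1.1 t.1.1.2 t.1.2 t.2 -> uniq (verts t).
Proof.
case: t => [[[a b] x] y] /= /path4_dirs[ab bx xy [ax ay by'] _].
have neq (u v w : G) : dir_of u w <> dir_of v w -> u != v.
  by move=> duv; apply/eqP => uv; apply: duv; rewrite uv.
rewrite !inE !negb_or !andbT (neq a b x) ?ax ?bx // (neq a x y) ?ay ?xy //.
rewrite (neq b x y) ?xy ?by' // (neq x y y) ?xy ?dir_ofxx //.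
rewrite (neq b y x) ?bx ?(dir_ofC x y) ?xy //.
by rewrite (neq a y b) ?ab // (dir_ofC b y) by'.
Qed.

(** The directed path has no automorphism but the identity: the arcs between its
    vertices recover their order. *)
Lemma path4_verts_inj : {in quadruples (is_path4 (@dir_of G)) &,
  injective (fun t => [set z in verts t]%SET)}.
Proof.
move=> [[[a b] x] y] [[[a' b'] x'] y']; rewrite !inE /=.
move=> P4; have := path4_uniq (P4 : is_path4 _ (a, b, x, y).1.1.1 _ _ _); move: P4.
move=> /path4_dirs[ab bx xy [ax ay by'] [ba xb yx xa [ya yb]]].
rewrite /= !inE !negb_or !andbT => /and3P[/and3P[/eqP aNb /eqP aNx /eqP aNy]
  /andP[/eqP bNx /eqP bNy] /eqP xNy].
move=> /path4_dirs[ab' bx' xy' _ _] /setP eqS.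
have mem (z : G) : z \in [:: a'; b'; x'; y'] -> [\/ z = a, z = b, z = x | z = y].
  move=> zS; have := eqS z; rewrite !inE => zE; move: zS; rewrite !inE -zE.
  by move=> /or4P[]/eqP->; [constructor 1|constructor 2|constructor 3|constructor 4].
have succ (u v : G) : dir_of u v = To ->
    [\/ u = a, u = b, u = x | u = y] -> [\/ v = a, v = b, v = x | v = y] ->
  [\/ u = a /\ v = b, u = b /\ v = x | u = x /\ v = y].
  by move=> uv [] uE [] vE; move: uv; rewrite uE vE
    ?dir_ofxx ?ab ?bx ?xy ?ax ?ay ?by' ?ba ?xb ?yx ?xa ?ya ?yb //;
   [constructor 1|constructor 2|constructor 3].
have [a'S b'S x'S y'S] : [/\ [\/ a' = a, a' = b, a' = x | a' = y],
  [\/ b' = a, b' = b, b' = x | b' = y], [\/ x' = a, x' = b, x' = x | x' = y] &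
  [\/ y' = a, y' = b, y' = x | y' = y]].
  by split; apply: mem; rewrite !inE eqxx ?orbT.
have [[-> -> ->] ->] : [/\ a' = a, b' = b & x' = x] /\ y' = y.
  have {}a'b' := succ _ _ ab' a'S b'S; have {}b'x' := succ _ _ bx' b'S x'S.
  have {}x'y' := succ _ _ xy' x'S y'S.
  by case: a'b' => -[? ?]; case: b'x' => -[? ?]; case: x'y' => -[? ?]; repeat split; congruence.
by [].
Qed.

Lemma induced_copies_path4 : induced_copies (dpath 4) G = path4s G.
Proof.
rewrite /path4s -card_quadruples -(card_in_imset path4_verts_inj).
rewrite /induced_copies card_ord.
congr #|pred_of_set _|; apply/setP => S; rewrite inE.
apply/andP/imsetP => [[/eqP cardS /asboolP[f [g fK gK] fE]] | [t]].
  pose h (i : 'I_4) := val (g (i : dpath 4)).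
  have hE (i j : dpath 4) : dir_of (h i) (h j) = dir_of i j.
    rewrite -[i in RHS]gK -[j in RHS]gK (dir_of_morph fE).
    exact: (dir_of_morph (f := (val : induced S -> G))).
  pose o (i : nat) (lti : (i < 4)%N) : dpath 4 := Ordinal lti.
  exists (h (@o 0 isT), h (@o 1 isT), h (@o 2 isT), h (@o 3 isT)).
    by rewrite inE /is_path4 /= !hE.
  apply/setP => z; rewrite inE; apply/idP/idP => [zS|].
    have -> : z = h (f (Sub z zS : induced S)) by rewrite /h fK SubK.
    rewrite /verts /= !inE; case: (f _) => [[|[|[|[|//]]]] lti];
      by rewrite (bool_irrelevance lti isT) eqxx ?orbT.
  by rewrite !inE => /or4P[]/eqP->; exact: valP.
rewrite inE => P4 ->; have Uv := path4_uniq P4.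
have cardS : #|[set z in verts t]%SET| = 4%N by rewrite cardsE (card_uniqP Uv).
split; first by rewrite cardS.
apply/asboolP; apply: isomorphic_sym.
have mem (i : 'I_4) : nth t.2 (verts t) i \in [set z in verts t]%SET.
  by rewrite inE mem_nth.
pose g (i : dpath 4) : induced [set z in verts t]%SET :=
    exist (fun z => z \in [set z in verts t]%SET) _ (mem i).
exists g.
  apply: inj_card_bij.
    move=> i j /(congr1 val) /eqP; rewrite nth_uniq // => /eqP.
    exact: val_inj.
  by rewrite card_sig card_ord cardS.
move=> i j.
rewrite -[LHS]dir_of_To -[RHS]dir_of_To; congr (_ == _).
have -> : dir_of (g i) (g j) = dir_of (val (g i)) (val (g j)) by [].
rewrite /=.
have [ab bx xy [ax ay by'] [ba xb yx xa [ya yb]]] := path4_dirs P4.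
case: i => [[|[|[|[|//]]]] lti]; case: j => [[|[|[|[|//]]]] ltj];
  rewrite /= ?dir_ofxx ?ab ?bx ?xy ?ax ?ay ?by' ?ba ?xb ?yx ?xa ?ya ?yb //.
Qed.

End InducedPaths.

(** * Balanced blow-ups *)

Lemma properly_labelled_T3free (G : ograph) (c : G -> C5) :
  properly_labelled c -> T3free G.
Proof.
move=> pl [f _ fE].
pose o (i : nat) (lti : (i < 3)%N) : transitive_tournament 3 := Ordinal lti.
have : [&& arc (c (f (@o 0 isT))) (c (f (@o 1 isT))),
           arc (c (f (@o 1 isT))) (c (f (@o 2 isT))) &
           arc (c (f (@o 0 isT))) (c (f (@o 2 isT)))] by rewrite -!pl !fE.
apply/negP; move: (c (f (@o 2 isT))); apply: all_C5P.
move: (c (f (@o 1 isT))); apply: all_C5P.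
by move: (c (f (@o 0 isT))); apply: all_C5P; vm_compute.
Qed.

Lemma balanced_path4s (B : ograph) : balanced_C5_blowup B ->
  T3free B /\ path4s B = e4max #|B|.
Proof.
move=> [c [sizes pl]]; split; first exact: properly_labelled_T3free pl.
by rewrite (proper_path4s pl); apply: e4_balanced (sum_class c) _ _ _ _ _; exact: sizes.
Qed.

Lemma extremal_balanced (G : ograph) (c : G -> C5) : properly_labelled c ->
  (0 < path4s G)%N -> (e4max #|G| <= path4s G)%N -> balanced_C5_blowup G.
Proof.
move=> pl; rewrite (proper_path4s pl) => P_gt0 max_le; exists c; split=> // i.
have [s0 s1 s2 s3 s4] := e4_eq_max (sum_class c) P_gt0 max_le.
by case: i => [[|[|[|[|[|//]]]]] lti] /=; rewrite (bool_irrelevance lti isT);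
  [exact: s0|exact: s1|exact: s2|exact: s3|exact: s4].
Qed.

Lemma isomorphic_balanced (G B : ograph) : isomorphic G B ->
  balanced_C5_blowup B -> balanced_C5_blowup G.
Proof.
move=> [f f_bij fE] [c [sizes pl]]; exists (c \o f); split.
  move=> i; rewrite (bij_eq_card f_bij) /=.
  suff -> : #|[set x | (c \o f) x == i]%SET| = #|[set x | c x == i]%SET| by exact: sizes.
  rewrite -[RHS](on_card_preimset (f := f)); last exact: onW_bij.
  by congr #|pred_of_set _|; apply/setP => x; rewrite !inE.
by move=> x y; rewrite -fE pl.
Qed.

Lemma isomorphic_refl (G : ograph) : isomorphic G G.
Proof. by exists id => //; exists id. Qed.

(** Labelling the vertices cyclically gives a balanced blow-up of every order. *)
Section CyclicBlowup.
Variable n : nat.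

Definition residue (x : 'I_n) : C5 := @Ordinal 5 (x %% 5) (ltn_pmod x (isT : (0 < 5)%N)).

Definition cyclic_arc : rel 'I_n := fun x y => @arc C5 (residue x) (residue y).

Lemma cyclic_arc_irr : irreflexive cyclic_arc.
Proof. by move=> x; exact: (@arc_irr C5). Qed.

Lemma cyclic_arc_asym x y : cyclic_arc x y -> ~~ cyclic_arc y x.
Proof. exact: (@arc_asym C5). Qed.

Definition cyclic_blowup : ograph := OGraph cyclic_arc_irr cyclic_arc_asym.

Lemma count_residue (j : nat) : (j < 5)%N ->
  (\sum_(x < n) (x %% 5 == j) = (n + 4 - j) %/ 5)%N.
Proof.
move=> lt_j5; elim: (n) => [|m IHm]; first by rewrite big_ord0; lia.
by rewrite big_ord_recr /= IHm; case: eqP => mj; lia.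
Qed.

Lemma cyclic_blowup_balanced : balanced_C5_blowup cyclic_blowup.
Proof.
exists residue; split=> // i; rewrite card_ord /=.
have -> : #|[set x | residue x == i]%SET| = ((n + 4 - i) %/ 5)%N.
  rewrite -(count_residue (ltn_ord i)) -sum1_card big_mkcond.
  apply: eq_bigr => x _; rewrite inE -val_eqE /=.
  by case: eqP.
by have := ltn_ord i; lia.
Qed.

End CyclicBlowup.

Lemma path4s_le_max (G : ograph) : T3free G -> (0 < #|G|)%N ->
  (2 ^ 21 * 153 ^ 3 <= #|G|)%N \/ (5 %| #|G|)%N -> (path4s G <= e4max #|G|)%N.
Proof.
move=> T3G G_gt0 n_cond; rewrite leqNgt; apply/negP => max_lt.
have [c pl] := near_extremal_labelled T3G G_gt0 n_cond (ltnW max_lt).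
by move: max_lt; rewrite (proper_path4s pl) ltnNge (e4_le_max (sum_class c)).
Qed.

Lemma maximizer_balanced (G : ograph) : T3free G -> (0 < #|G|)%N ->
  (2 ^ 21 * 153 ^ 3 <= #|G|)%N \/ (5 %| #|G|)%N ->
  (e4max #|G| <= path4s G)%N -> balanced_C5_blowup G.
Proof.
move=> T3G G_gt0 n_cond max_le.
have [c pl] := near_extremal_labelled T3G G_gt0 n_cond max_le.
exact: extremal_balanced pl (leq_trans (e4max_gt0 G_gt0 n_cond) max_le) max_le.
Qed.

(** * The limit density *)

Lemma bin4_bounds n :
  (24 * 'C(n, 4) <= n ^ 4)%N /\ (n ^ 4 <= 24 * 'C(n, 4) + 6 * n ^ 3)%N.
Proof.
have -> : (24 * 'C(n, 4) = n * (n.-1 * (n.-2 * n.-2.-1)))%N.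
  by rewrite mulnC -[24%N]/(4`!)%N bin_ffact !ffactnS ffactn0 muln1.
case: n => [|[|[|n]]] //=; split; nia.
Qed.

Lemma e4max_upper n : (125 * e4max n <= n ^ 4)%N.
Proof.
have [T3B PB] := balanced_path4s (cyclic_blowup_balanced n).
have := path4_misfit_bound T3B; rewrite PB card_ord; lia.
Qed.

Lemma density_path4 (R : realType) (G : ograph) :
  density R (dpath 4) G = (path4s G)%:R / 'C(#|G|, 4)%:R.
Proof. by rewrite /density induced_copies_path4 card_ord. Qed.

(** The numbers [24 * 'C(n, 4)] and [125 * e4max n] differ from [n ^ 4] by at most
    [6 n ^ 3] and [16 n ^ 2] respectively, so that their
    difference is of relative order [1 / n]. *)
Lemma e4max_density_close (R : realType) (n : nat) : (12 <= n)%N ->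
  `|24 / 125 - (e4max n)%:R / 'C(n, 4)%:R| <= 4 / n%:R :> R.
Proof.
move=> n_ge12.
have C_gt0 : 0 < 'C(n, 4)%:R :> R by rewrite ltr0n bin_gt0; lia.
have n_gt0 : 0 < n%:R :> R by rewrite ltr0n; lia.
have [C_le C_ge] := bin4_bounds n.
have E_le := e4max_upper n; have E_ge := e4max_lower n.
have n3_le : (12 * n ^ 3 <= n ^ 4)%N by rewrite (expnS n 3) leq_mul2r n_ge12 orbT.
have n2_le : (12 * n ^ 2 <= n ^ 3)%N by rewrite (expnS n 2) leq_mul2r n_ge12 orbT.
have close1 : (n * (125 * e4max n) <= n * (24 * 'C(n, 4)) + 500 * 'C(n, 4))%N.
  have : (n * (125 * e4max n) <= n * (24 * 'C(n, 4) + 6 * n ^ 3))%N.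
    by rewrite leq_mul2l; apply/orP; right; lia.
  by rewrite mulnDr [(n * (6 * _))%N]mulnCA -expnS; lia.
have close2 : (n * (24 * 'C(n, 4)) <= n * (125 * e4max n) + 500 * 'C(n, 4))%N.
  have : (n * (24 * 'C(n, 4)) <= n * (125 * e4max n + 6 * n ^ 3))%N.
    by rewrite leq_mul2l; apply/orP; right; lia.
  by rewrite mulnDr [(n * (6 * _))%N]mulnCA -expnS; lia.
move: close1 close2 C_gt0 {C_le C_ge E_le E_ge n3_le n2_le}.
move: (e4max n) 'C(n, 4)%N => E C close1 close2 C_gt0.
have {}close1 : n%:R * (125 * E%:R) <= n%:R * (24 * C%:R) + 500 * C%:R :> R.
  by rewrite -!natrM -natrD ler_nat.
have {}close2 : n%:R * (24 * C%:R) <= n%:R * (125 * E%:R) + 500 * C%:R :> R.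
  by rewrite -!natrM -natrD ler_nat.
have EC : E%:R = E%:R / C%:R * C%:R :> R by rewrite divfK // gt_eqF.
move: close1 close2; rewrite EC mulfK ?gt_eqF //.
move: (E%:R / C%:R : R) => q {EC}.
move: (C%:R : R) (n%:R : R) C_gt0 n_gt0 => k m k_gt0 m_gt0.
have -> : m * (125 * (q * k)) = 125 * m * q * k by ring.
have -> : m * (24 * k) + 500 * k = (24 * m + 500) * k by ring.
have -> : m * (24 * k) = 24 * m * k by ring.
have -> : 125 * m * q * k + 500 * k = (125 * m * q + 500) * k by ring.
rewrite !ler_pM2r // => close1 close2.
rewrite ler_pdivlMr // -(gtr0_norm m_gt0) -normrM ler_norml.
by apply/andP; split; lra.
Qed.

Lemma e4max_density_cvg (R : realType) :
  ((fun n => (e4max n)%:R / 'C(n, 4)%:R) @ \oo --> (24 / 125 : R))%classic.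
Proof.
apply/cvgrPdist_le => /= e e_gt0; near=> n.
apply: le_trans (e4max_density_close R _) _; first by near: n; exact: nbhs_infty_ge.
rewrite ler_pdivrMr; last by rewrite ltr0n; near: n; exact: nbhs_infty_gt.
by rewrite -ler_pdivrMl // mulrC; near: n; exact: nbhs_infty_ger.
Unshelve. all: by end_near. Qed.

Theorem theorem3 (R : realType) :
  is_inducibility (dpath 4) T3free (24%:R / 125%:R : R) /\
  (exists n1 : nat, forall n : nat,
     (0 < n)%N -> ((n1 <= n)%N \/ (5 %| n)%N) ->
     forall G : ograph, #|G| = n -> T3free G ->
       (maximizes_copies (dpath 4) T3free G <->
        exists B : ograph,
          [/\ #|B| = n, balanced_C5_blowup B & isomorphic G B])).
Proof.
split.
  exists (fun n => (e4max n)%:R / 'C(n, 4)%:R); last exact: e4max_density_cvg.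
  near=> n; split.
    have [T3B PB] := balanced_path4s (cyclic_blowup_balanced n).
    exists (cyclic_blowup n); split=> //; first exact: card_ord.
    by rewrite density_path4 PB card_ord.
  move=> G T3G Gn; rewrite density_path4 Gn ler_wpM2r ?invr_ge0 // ler_nat -Gn.
  apply: path4s_le_max => //; rewrite Gn; first by near: n; exact: nbhs_infty_gt.
  by left; near: n; exact: nbhs_infty_ge.
exists (2 ^ 21 * 153 ^ 3)%N => n n_gt0 n_cond G Gn T3G; subst n.
split=> [[_ maxG] | [B [BG balB isoGB]]].
  exists G; split=> //; last exact: isomorphic_refl.
  apply: maximizer_balanced => //.
  have [T3B PB] := balanced_path4s (cyclic_blowup_balanced #|G|).
  have := maxG _ T3B (card_ord _); rewrite !induced_copies_path4 PB.
  by rewrite card_ord.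
have [_ PG] := balanced_path4s (isomorphic_balanced isoGB balB).
split=> // G' T3G' GG'; rewrite !induced_copies_path4 PG -GG'.
by apply: path4s_le_max; rewrite ?GG'.
Unshelve. all: by end_near. Qed.
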